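(* Let $X$ be a Hadamard space with linear dual space $X^{\lozenge}$ and let $p\in X$. Associate to any mapping $h:X\times X^{\lozenge}\to[-\infty,\infty]$ the set-valued map $S_{h,p}:X\multimap X^{\lozenge}$ defined by $$S_{h,p}(x):=\{x^{\lozenge}\in X^{\lozenge}: h(x,x^{\lozenge})=\pi_p(x,x^{\lozenge})\}.$$ If $h\in\Gamma_p^{\lozenge}(X)$, then $\Phi^p_{S_{h,p}}=h$.
   Context: A Hadamard space is a (nonempty) complete $\mathrm{CAT}(0)$ space $(X,d)$. For $x,y\in X$ and $t\in[0,1]$, $(1-t)x\oplus ty$ denotes the point $c(t)$ of the unique constant-speed geodesic $c:[0,1]\to X$ from $x$ to $y$. Quasilinearization: for $x,y,u,v\in X$, $\langle\overrightarrow{xy},\overrightarrow{uv}\rangle:=\frac12\big(d(x,v)^2+d(y,u)^2-d(x,u)^2-d(y,v)^2\big)$. Dual spaces: for $t\in\mathbb R$, $a,b\in X$, $[t\overrightarrow{ab}]$ is the class of $(t,a,b)\in\mathbb R\times X^2$ under the relation $(t,a,b)\sim(s,c,d)$ iff $t\langle\overrightarrow{ab},\overrightarrow{xy}\rangle=s\langle\overrightarrow{cd},\overrightarrow{xy}\rangle$ for all $x,y\in X$; it is identified with the function $\overrightarrow{xy}\mapsto t\langle\overrightarrow{ab},\overrightarrow{xy}\rangle$ on $X^2$. $X^*$ is the set of all such classes, and the linear dual $X^{\lozenge}$ is the real vector space of all finite linear combinations $\sum_i\alpha_i x_i^*$ ($\alpha_i\in\mathbb R$, $x_i^*\in X^*$),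 acting on $X^2$ by $\langle\sum_i\alpha_ix_i^*,\overrightarrow{xy}\rangle=\sum_i\alpha_i\langle x_i^*,\overrightarrow{xy}\rangle$ (elements with the same action are equal). $X^{\lozenge}$ carries the norm $\|x^{\lozenge}\|_{\lozenge}=\sup\Big\{\frac{|\langle x^{\lozenge},\overrightarrow{ab}\rangle-\langle x^{\lozenge},\overrightarrow{cd}\rangle|}{d(a,b)+d(c,d)}: a,b,c,d\in X,\ (a,c)\ne(b,d)\Big\}$, and $X\times X^{\lozenge}$ the product topology. For $h:X\times X^{\lozenge}\to[-\infty,\infty]$: $h$ is proper if it never takes the value $-\infty$ and $h\not\equiv\infty$; l.s.c. if its epigraph is closed; convex if $h((1-\lambda)x\oplus\lambda y,(1-\lambda)x^{\lozenge}+\lambda y^{\lozenge})\le(1-\lambda)h(x,x^{\lozenge})+\lambda h(y,y^{\lozenge})$ for all $(x,x^{\lozenge}),(y,y^{\lozenge})$ and $\lambda\in[0,1]$. $\Gamma(X\times X^{\lozenge})$ is the set of proper, l.s.c., convex $h:X\times X^{\lozenge}\to[-\infty,\infty]$. Fix $p\in X$. $\pi_p(x,x^{\lozenge}):=\langle x^{\lozenge},\overrightarrow{px}\rangle$ on $X\times X^{\lozenge}$; $r(x,x^{\lozenge}):=(x^{\lozenge},x)$. The indicator $\iota_A$ equals $0$ on $A$ and $\infty$ off $A$. $\{h\le\pi_p\}:=\{(x,x^{\lozenge}):h(x,x^{\lozenge})\le\pi_p(x,x^{\lozenge})\}$. The $p$-Fenchel conjugate $h_p^{\lozenge}:X^{\lozenge}\times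 X\to[-\infty,\infty]$ is $$h_p^{\lozenge}(x^{\lozenge},x)=\sup_{(y,y^{\lozenge})\in X\times X^{\lozenge}}\{\langle x^{\lozenge},\overrightarrow{py}\rangle+\langle y^{\lozenge},\overrightarrow{px}\rangle-h(y,y^{\lozenge})\}.$$ $\Gamma_p^{\lozenge}(X):=\{h\in\Gamma(X\times X^{\lozenge}): h=(h+\iota_{\{h\le\pi_p\}})_p^{\lozenge}\circ r\text{ on }X\times X^{\lozenge}\}$. For a set-valued operator $T:X\multimap X^{\lozenge}$ (a map assigning to each $x\in X$ a possibly empty subset $T(x)\subseteq X^{\lozenge}$), $\mathrm{gra}(T)=\{(x,x^{\lozenge}):x^{\lozenge}\in T(x)\}$. The $p$-Fitzpatrick transform of $T$ is $\Phi^p_T:X\times X^{\lozenge}\to[-\infty,\infty]$, $$\Phi^p_T(x,x^{\lozenge})=\sup_{(y,y^{\lozenge})\in\mathrm{gra}(T)}\{\langle x^{\lozenge},\overrightarrow{py}\rangle-\langle y^{\lozenge},\overrightarrow{xy}\rangle\}.$$ *)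

(* Defs.v *)
From HB Require Import structures.
From mathcomp Require Import all_boot all_order all_algebra ring lra.
From mathcomp Require Import all_classical all_reals all_analysis.

Set Implicit Arguments.
Unset Strict Implicit.
Unset Printing Implicit Defensive.

Import Order.TTheory GRing.Theory Num.Theory.
Import numFieldNormedType.Exports.

Local Open Scope classical_set_scope.
Local Open Scope ring_scope.

(* The library norm on ['rV[R]_2] is the max norm, hence the explicit formula *)
Definition euclidean_dist (R : realType) (u v : 'rV[R]_2) : R :=
  Num.sqrt (\sum_i (u 0 i - v 0 i) ^+ 2).

Definition is_geodesic (R : realType) (X : metricType R) (x y : X)
    (c : R -> X) : Prop :=
  [/\ c 0 = x, c 1 = y &
      forall s t, 0 <= s <= 1 -> 0 <= t <= 1 ->
        mdist (c s) (c t) = `|s - t| * mdist x y].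

(* The vertices of a geodesic triangle are indexed by ['I_3], with addition
   modulo 3: the side [c i] joins [v i] to [v (i + 1)]. *)
Definition geodesic_triangle (R : realType) (X : metricType R)
    (v : 'I_3 -> X) (c : 'I_3 -> R -> X) : Prop :=
  forall i, is_geodesic (v i) (v (i + 1)) (c i).

Definition comparison_triangle (R : realType) (X : metricType R)
    (v : 'I_3 -> X) (w : 'I_3 -> 'rV[R]_2) : Prop :=
  forall i j, euclidean_dist (w i) (w j) = mdist (v i) (v j).

Definition CAT0 (R : realType) (X : metricType R) : Prop :=
  (forall x y : X, exists c, is_geodesic x y c) /\
  forall (v : 'I_3 -> X) c w,
    geodesic_triangle v c -> comparison_triangle v w ->
    forall i j s t, 0 <= s <= 1 -> 0 <= t <= 1 ->
      mdist (c i s) (c j t) <=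
      euclidean_dist ((1 - s) *: w i + s *: w (i + 1))
                     ((1 - t) *: w j + t *: w (j + 1)).

HB.mixin Record Metric_isCAT0 (R : realType) X & Metric R X := {
  cat0 : CAT0 X
}.

(* [Complete] requires a point, so the carrier is nonempty *)
#[short(type="hadamardType")]
HB.structure Definition Hadamard (R : realType) :=
  {X of Complete X & Metric R X & Metric_isCAT0 R X}.

Lemma comparison_triangle_ex (R : realType) (X : metricType R)
    (v : 'I_3 -> X) : exists w, comparison_triangle v w.
Proof.
set c := mdist (v 0) (v 1); set b := mdist (v 0) (v 2); set a := mdist (v 1) (v 2).
have a0 : 0 <= a by exact: mdist_ge0.
have b0 : 0 <= b by exact: mdist_ge0.
have c0 : 0 <= c by exact: mdist_ge0.
have tac : c <= b + a by rewrite /a [mdist (v 1) _]metric_sym metric_triangle.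
have tab : a <= c + b by rewrite /c [mdist (v 0) (v 1)]metric_sym metric_triangle.
have tba : b <= c + a by exact: metric_triangle.
have [p [q [pq1 pq2]]] : exists p q : R,
    p ^+ 2 + q ^+ 2 = b ^+ 2 /\ (p - c) ^+ 2 + q ^+ 2 = a ^+ 2.
  have [c00|cn0] := eqVneq c 0.
    exists b, 0; split; first by ring.
    have -> : a = b by lra.
    by rewrite c00; ring.
  have cp : 0 < c by rewrite lt_neqAle eq_sym cn0.
  pose p := (b ^+ 2 + c ^+ 2 - a ^+ 2) / (2 * c).
  have pc : p * (2 * c) = b ^+ 2 + c ^+ 2 - a ^+ 2.
    by rewrite /p divfK// mulf_neq0// pnatr_eq0.
  have q0 : 0 <= b ^+ 2 - p ^+ 2.
    have : 0 <= (b ^+ 2 - p ^+ 2) * (2 * c) ^+ 2.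
      have -> : (b ^+ 2 - p ^+ 2) * (2 * c) ^+ 2 =
          (2 * b * c) ^+ 2 - (p * (2 * c)) ^+ 2 by ring.
      rewrite pc.
      have -> : (2 * b * c) ^+ 2 - (b ^+ 2 + c ^+ 2 - a ^+ 2) ^+ 2 =
        ((c + b - a) * (c + b + a)) * ((b + a - c) * (c + a - b)) by ring.
      by apply: mulr_ge0; apply: mulr_ge0; lra.
    by rewrite pmulr_lge0// exprn_gt0// mulr_gt0.
  exists p, (Num.sqrt (b ^+ 2 - p ^+ 2)); rewrite sqr_sqrtr//; split; first by ring.
  have -> : (p - c) ^+ 2 + (b ^+ 2 - p ^+ 2) = c ^+ 2 - p * (2 * c) + b ^+ 2
    by ring.
  by rewrite pc; ring.
pose w (i : 'I_3) : 'rV[R]_2 := \row_j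
  nth 0 (nth [::] [:: [:: 0; 0]; [:: c; 0]; [:: p; q]] i) j.
have E (x y : 'rV[R]_2) (r : R) : 0 <= r ->
    (x 0 0 - y 0 0) ^+ 2 + (x 0 1 - y 0 1) ^+ 2 = r ^+ 2 ->
    euclidean_dist x y = r.
  move=> r0 xy; rewrite /euclidean_dist 2!big_ord_recl big_ord0 addr0.
  have -> : lift ord0 ord0 = 1 :> 'I_2 by apply: val_inj.
  by rewrite xy sqrtr_sqr ger0_norm.
have sym (x y : 'rV[R]_2) : euclidean_dist x y = euclidean_dist y x.
  rewrite /euclidean_dist; congr Num.sqrt.
  by apply: eq_bigr => i _; rewrite -sqrrN opprB.
have w01 : euclidean_dist (w 0) (w 1) = c.
  by apply: E => //; rewrite !mxE /=; ring.
have w02 : euclidean_dist (w 0) (w 2) = b.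
  by apply: E => //; rewrite !mxE /= -pq1; ring.
have w12 : euclidean_dist (w 1) (w 2) = a.
  by apply: E => //; rewrite !mxE /= -pq2; ring.
have wxx i : euclidean_dist (w i) (w i) = 0.
  by apply: E => //; ring.
have I3 (i : 'I_3) : [\/ i = 0, i = 1 | i = 2].
  by case: i => -[|[|[|//]]] i3; [constructor 1|constructor 2|constructor 3];
     apply: val_inj.
exists w => i j.
by case: (I3 i) => ->; case: (I3 j) => ->;
  rewrite ?wxx ?mdistxx// ?w01 ?w02 ?w12//;
  rewrite sym metric_sym ?w01 ?w02 ?w12.
Qed.

Section hadamard_theory.
Context {R : realType} {X : hadamardType R}.
Implicit Types x y z : X.

Lemma geodesic_ex x y : exists c : R -> X, is_geodesic x y c.
Proof. by have [] := @cat0 R X. Qed.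

Lemma bruhat_tits x y z (c : R -> X) (t : R) :
  is_geodesic x y c -> 0 <= t <= 1 ->
  mdist (c t) z ^+ 2 <= (1 - t) * mdist x z ^+ 2 + t * mdist y z ^+ 2
    - t * (1 - t) * mdist x y ^+ 2.
Proof.
move=> gc t01.
have [c1 gc1] := geodesic_ex y z; have [c2 gc2] := geodesic_ex z x.
pose v (i : 'I_3) := nth x [:: x; y; z] i.
pose cc (i : 'I_3) := nth c [:: c; c1; c2] i.
have tri : geodesic_triangle v cc by case=> -[|[|[|//]]] i3.
have [w hw] := comparison_triangle_ex v.
have h01 : 0 <= (0 : R) <= 1 by apply/andP; split.
have := (@cat0 R X).2 _ _ _ tri hw 0 2 _ _ t01 h01.
rewrite subr0 scale1r scale0r addr0 add0r.
have -> : cc 0 = c by [].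
have -> : cc 2 0 = z by rewrite /cc /=; case: gc2.
have sq (u u' : 'rV[R]_2) : euclidean_dist u u' ^+ 2 =
    (u 0 0 - u' 0 0) ^+ 2 + (u 0 1 - u' 0 1) ^+ 2.
  rewrite /euclidean_dist sqr_sqrtr; last first.
    by apply: sumr_ge0 => i _; exact: sqr_ge0.
  rewrite 2!big_ord_recl big_ord0 addr0.
  by have -> : lift ord0 ord0 = 1 :> 'I_2 by apply: val_inj.
have wxy : euclidean_dist (w 0) (w 1) = mdist x y by rewrite hw.
have wxz : euclidean_dist (w 0) (w 2) = mdist x z by rewrite hw.
have wyz : euclidean_dist (w 1) (w 2) = mdist y z by rewrite hw.
rewrite -(ler_pXn2r (n := 2))// ?nnegrE ?mdist_ge0 ?sqrtr_ge0//.
move=> /le_trans; apply.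
rewrite -wxy -wxz -wyz !sq !mxE le_eqVlt; apply/orP; left; apply/eqP; ring.
Qed.

Lemma geodesic_unique x y (c c' : R -> X) (t : R) :
  is_geodesic x y c -> is_geodesic x y c' -> 0 <= t <= 1 -> c t = c' t.
Proof.
move=> gc gc' t01; have /andP[t0 t1] := t01; apply: mdist_positivity.
have := bruhat_tits (c' t) gc t01.
case: gc' => c'0 c'1 /[dup] /(_ 0 t) + /(_ 1 t); rewrite c'0 c'1.
have h0 : 0 <= (0 : R) <= 1 by apply/andP; split.
have h1 : 0 <= (1 : R) <= 1 by apply/andP; split.
move=> /(_ h0 t01) -> /(_ h1 t01) ->.
rewrite sub0r normrN (ger0_norm t0) ger0_norm ?subr_ge0// => H.
apply/eqP; rewrite -sqrf_eq0 eq_le sqr_ge0 andbT (le_trans H)// le_eqVlt.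
by apply/orP; left; apply/eqP; ring.
Qed.

End hadamard_theory.

(* (1 - t) x (+) t y *)
Definition geodesic_comb (R : realType) (X : hadamardType R) (x y : X)
  (t : R) : X := sval (cid (geodesic_ex x y)) t.

Lemma geodesic_combE (R : realType) (X : hadamardType R) (x y : X)
    (c : R -> X) (t : R) :
  is_geodesic x y c -> 0 <= t <= 1 -> geodesic_comb x y t = c t.
Proof.
by move=> gc; apply: geodesic_unique gc; exact: svalP.
Qed.

Definition quasilin (R : realType) (X : metricType R) (x y u v : X) : R :=
  (mdist x v ^+ 2 + mdist y u ^+ 2 - mdist x u ^+ 2 - mdist y v ^+ 2) / 2.

Lemma quasilin_cauchy_schwarz (R : realType) (X : hadamardType R)
  (x y u v : X) : quasilin x y u v <= mdist x y * mdist u v.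
Proof.
set a := mdist x y; set b := mdist u v.
have a0 : 0 <= a by exact: mdist_ge0.
have b0 : 0 <= b by exact: mdist_ge0.
suff H (e : R) : 0 < e -> quasilin x y u v <= (a + e) * (b + e).
  apply/ler_addgt0Pr => e e0.
  pose d := Num.min 1 (e / (a + b + 1)).
  have s0 : 0 < a + b + 1 by lra.
  have d0 : 0 < d by rewrite lt_min ltr01 divr_gt0.
  have d1 : d <= 1 by rewrite ge_min lexx.
  have de : d * (a + b + 1) <= e by rewrite -ler_pdivlMr// ge_min lexx orbT.
  apply: (le_trans (H _ d0)).
  have : d * d <= d * 1 by rewrite ler_wpM2l// ltW.
  by nra.
move=> e0; set a' := a + e; set b' := b + e.
have a'0 : 0 < a' by rewrite /a'; lra.
have b'0 : 0 < b' by rewrite /b'; lra.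
pose t := a' / (a' + b').
have s0 : 0 < a' + b' by lra.
have t0 : 0 < t by rewrite divr_gt0.
have tE : 1 - t = b' / (a' + b') by rewrite /t; field; rewrite gt_eqF.
have t1 : 0 < 1 - t by rewrite tE divr_gt0.
have t01 : 0 <= t <= 1 by apply/andP; split; lra.
have [c gc] := geodesic_ex x v.
have Hy := bruhat_tits y gc t01; have Hu := bruhat_tits u gc t01.
set m := mdist (c t) y in Hy; set n := mdist (c t) u in Hu.
have tri : mdist y u <= m + n.
  by rewrite /m [mdist (c t) y]metric_sym metric_triangle.
have m0 : 0 <= m by exact: mdist_ge0.
have n0 : 0 <= n by exact: mdist_ge0.
have yu0 : 0 <= mdist y u by exact: mdist_ge0.
have sq : mdist y u ^+ 2 <= m ^+ 2 / t + n ^+ 2 / (1 - t).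
  apply: (@le_trans _ _ ((m + n) ^+ 2)); first by rewrite ler_pXn2r// nnegrE addr_ge0.
  rewrite -subr_ge0.
  have -> : m ^+ 2 / t + n ^+ 2 / (1 - t) - (m + n) ^+ 2 =
      ((1 - t) * m - t * n) ^+ 2 / (t * (1 - t)).
    by field; rewrite !gt_eqF.
  by rewrite divr_ge0 ?sqr_ge0// mulr_ge0// ltW.
move: Hy Hu; rewrite -/a [mdist v u]metric_sym -/b => Hy Hu.
have Hy' : m ^+ 2 / t <= (1 - t) / t * a ^+ 2 + mdist v y ^+ 2
    - (1 - t) * mdist x v ^+ 2.
  rewrite ler_pdivrMr//; apply: (le_trans Hy); rewrite le_eqVlt; apply/orP; left.
  by apply/eqP; field; rewrite gt_eqF.
have Hu' : n ^+ 2 / (1 - t) <= mdist x u ^+ 2 + t / (1 - t) * b ^+ 2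
    - t * mdist x v ^+ 2.
  rewrite ler_pdivrMr//; apply: (le_trans Hu); rewrite le_eqVlt; apply/orP; left.
  by apply/eqP; field; rewrite gt_eqF.
have r1 : (1 - t) / t * a ^+ 2 <= a' * b'.
  have -> : (1 - t) / t = b' / a'.
    by rewrite tE /t; field; rewrite !gt_eqF.
  rewrite mulrAC ler_pdivrMr//.
  have -> : a' * b' * a' = b' * a' ^+ 2 by ring.
  apply: ler_wpM2l; first exact: ltW.
  by rewrite ler_pXn2r// ?nnegrE ?ltW// /a'; lra.
have r2 : t / (1 - t) * b ^+ 2 <= a' * b'.
  have -> : t / (1 - t) = a' / b'.
    by rewrite tE /t; field; rewrite !gt_eqF.
  rewrite mulrAC ler_pdivrMr// -mulrA; apply: ler_wpM2l; first exact: ltW.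
  by rewrite -expr2 ler_pXn2r// ?nnegrE ?ltW// /b'; lra.
rewrite /quasilin ler_pdivrMr// [mdist y v]metric_sym.
by lra.
Qed.

(* An element of X^* is identified with its action on X^2, and so is an
   element of the linear dual. *)
Definition dual_space (R : realType) (X : metricType R) : set (X * X -> R^o) :=
  [set f | exists t a b, f = fun z => t * quasilin a b z.1 z.2].

Definition linear_span_dual (R : realType) (X : metricType R) :
    pred (X * X -> R^o) :=
  fun f => `[< exists n (alpha : 'I_n -> R) (xs : 'I_n -> (X * X -> R^o)),
    (forall i, dual_space (xs i)) /\ f = \sum_i alpha i *: xs i >].

Lemma linear_span_dual_submod_closed (R : realType) (X : metricType R) :
  submod_closed (@linear_span_dual R X).
Proof.
split=> [|k f g].
  rewrite /in_mem/=; apply/asboolP; exists 0%N, (fun=> 0), (fun=> 0).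
  by rewrite big_ord0; split => // -[].
rewrite /in_mem/= => /asboolP[n [al [xs [xsP ->]]]] /asboolP[m [be [ys [ysP ->]]]].
apply/asboolP; exists (n + m)%N,
  (fun i : 'I_(n + m) => match fintype.split i with inl j => k * al j | inr j => be j end),
  (fun i : 'I_(n + m) => match fintype.split i with inl j => xs j | inr j => ys j end).
split=> [i|]; first by case: splitP.
rewrite big_split_ord/= scaler_sumr; congr (_ + _); apply: eq_bigr => i _.
  by rewrite -[lshift _ _]/(unsplit (inl i)) unsplitK scalerA.
by rewrite -[rshift _ _]/(unsplit (inr i)) unsplitK.
Qed.

HB.instance Definition _ (R : realType) (X : metricType R) :=
  GRing.isSubmodClosed.Build R (X * X -> R^o) (@linear_span_dual R X)
    (@linear_span_dual_submod_closed R X).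

Record linear_dual (R : realType) (X : hadamardType R) := LinearDual {
  dual_action :> X * X -> R^o ;
  dual_actionP : linear_span_dual dual_action
}.

Section linear_dual.
Context {R : realType} {X : hadamardType R}.
Local Notation dual := (linear_dual X).

HB.instance Definition _ := [isSub for @dual_action R X].
HB.instance Definition _ := [Choice of dual by <:].
HB.instance Definition _ := [SubChoice_isSubLmodule of dual by <:].

Definition dual_quotients (f : dual) : set R :=
  [set r | exists a b c d : X, (a, c) <> (b, d) /\
    r = `|f (a, b) - f (c, d)| / (mdist a b + mdist c d)].

(* [sup set0 = 0], so the norm is 0 when [X] is a singleton; [dual_norm_ub]
   shows that the supremum is otherwise a genuine one. *)
Definition dual_norm (f : dual) : R := sup (dual_quotients f).

Let den_gt0 (a b c d : X) : (a, c) <> (b, d) -> 0 < mdist a b + mdist c d.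
Proof.
move=> h; rewrite lt_neqAle addr_ge0 ?mdist_ge0// andbT eq_sym.
rewrite paddr_eq0 ?mdist_ge0//; apply/negP => /andP[/eqP ab /eqP cd].
by apply: h; rewrite (mdist_positivity _ _ ab) (mdist_positivity _ _ cd).
Qed.

Lemma dual_action_diag (f : dual) (x : X) : f (x, x) = 0 :> R.
Proof.
case: f => f /= /asboolP[n [al [xs [xsP ->]]]].
rewrite fct_sumE big1// => i _; rewrite /GRing.scale/=.
have [t [a [b ->]]] := xsP i => /=.
by rewrite /quasilin /GRing.scale/=; ring.
Qed.

Let lip (f : dual) : exists2 M, 0 <= M &
  forall x y u v, `|f (x, y) - f (u, v)| <= M * (mdist x y + mdist u v).
Proof.
case: f => f /= /asboolP[n [al [xs [xsP ->]]]].
suff /choice[M MP] (i : 'I_n) : exists M : R, 0 <= M /\ forall x y u v,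
    `|(al i *: xs i) (x, y) - (al i *: xs i) (u, v)| <=
    M * (mdist x y + mdist u v).
  exists (\sum_i M i); first by apply: sumr_ge0 => i _; case: (MP i).
  move=> x y u v; rewrite !fct_sumE -sumrB mulr_suml.
  by apply: (le_trans (ler_norm_sum _ _ _)); apply: ler_sum => i _; case: (MP i).
have [t [a [b ->]]] := xsP i.
exists (`|al i * t| * mdist a b); split.
  by rewrite mulr_ge0// mdist_ge0.
move=> x y u v.
set D := (X in `|X|).
have -> : D = (al i * t) * (quasilin a b x y - quasilin a b u v).
  by rewrite /D /GRing.scale/= /GRing.scale/= mulrBr !mulrA.
rewrite normrM -mulrA.
have cs (x' y' : X) : `|quasilin a b x' y'| <= mdist a b * mdist x' y'.
  rewrite ler_norml quasilin_cauchy_schwarz andbT lerNl.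
  have -> : - quasilin a b x' y' = quasilin a b y' x'.
    by rewrite /quasilin; ring.
  by rewrite [mdist x' y']metric_sym quasilin_cauchy_schwarz.
rewrite ler_wpM2l// (le_trans (ler_normB _ _))// mulrDr.
by rewrite lerD.
Qed.

Let dual_quotients_ub (f : dual) : has_ubound (dual_quotients f).
Proof.
have [M M0 MP] := lip f; exists M => _ [a [b [c [d [/den_gt0 h ->]]]]].
by rewrite ler_pdivrMr.
Qed.

Let norm_le (f : dual) (M : R) : 0 <= M ->
  (forall a b c d, `|f (a, b) - f (c, d)| <= M * (mdist a b + mdist c d)) ->
  dual_norm f <= M.
Proof.
move=> M0 MP; have [q0|/set0P q0] := eqVneq (dual_quotients f) set0.
  by rewrite /dual_norm q0 sup0.
apply: ge_sup => // _ [a [b [c [d [/den_gt0 h ->]]]]].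
by rewrite ler_pdivrMr.
Qed.

Lemma dual_norm_ge0 (f : dual) : 0 <= dual_norm f.
Proof.
have [q0|/set0P[r qr]] := eqVneq (dual_quotients f) set0.
  by rewrite /dual_norm q0 sup0.
apply: (@le_trans _ _ r); last exact: (ub_le_sup (dual_quotients_ub f) qr).
case: qr => a [b [c [d [/den_gt0 h ->]]]].
by rewrite divr_ge0// ltW.
Qed.

Lemma dual_norm_ub (f : dual) (a b c d : X) :
  `|f (a, b) - f (c, d)| <= dual_norm f * (mdist a b + mdist c d).
Proof.
have [[-> ->]|h] := pselect ((a, c) = (b, d)).
  rewrite !dual_action_diag subrr normr0 mulr_ge0 ?dual_norm_ge0//.
  by apply: addr_ge0; exact: mdist_ge0.
rewrite -ler_pdivrMr ?den_gt0//; apply: ub_le_sup; first exact: dual_quotients_ub.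
by exists a, b, c, d.
Qed.

Let dual_normD (f g : dual) : dual_norm (f + g) <= dual_norm f + dual_norm g.
Proof.
apply: norm_le => [|a b c d]; first by rewrite addr_ge0// dual_norm_ge0.
have -> : (f + g) (a, b) - (f + g) (c, d) =
    (f (a, b) - f (c, d)) + (g (a, b) - g (c, d)).
  by rewrite addrACA -opprD.
by rewrite (le_trans (ler_normD _ _))// mulrDl lerD// dual_norm_ub.
Qed.

Let dual_normZ_le (k : R) (f : dual) : dual_norm (k *: f) <= `|k| * dual_norm f.
Proof.
apply: norm_le => [|a b c d]; first by rewrite mulr_ge0// dual_norm_ge0.
have -> : (k *: f) (a, b) - (k *: f) (c, d) = k * (f (a, b) - f (c, d)).
  by rewrite mulrBr.
by rewrite normrM -mulrA ler_wpM2l// dual_norm_ub.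
Qed.

Let dual_normZ (k : R) (f : dual) : dual_norm (k *: f) = `|k| * dual_norm f.
Proof.
apply/eqP; rewrite eq_le dual_normZ_le/=.
have [->|k0] := eqVneq k 0; first by rewrite normr0 mul0r dual_norm_ge0.
rewrite -ler_pdivlMl ?normr_gt0//.
rewrite -[f in leLHS](scalerK k0) -normfV.
exact: dual_normZ_le.
Qed.

Let dual_norm0 (f : dual) : dual_norm f = 0 -> f = 0.
Proof.
move=> f0; apply: val_inj; apply/funext => -[a b].
have := dual_norm_ub f a b a a.
by rewrite f0 mul0r dual_action_diag subr0 normr_le0 => /eqP.
Qed.

HB.instance Definition _ :=
  Lmodule_isNormed.Build R dual dual_normD dual_normZ dual_norm0.

End linear_dual.

Definition dual_pairing (R : realType) (X : hadamardType R)
  (xs : linear_dual X) (x y : X) : R := xs (x, y).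

Section gamma.
Context {R : realType} {X : hadamardType R}.
Local Notation dual := (linear_dual X).
Implicit Types (p : X) (h : X * dual -> \bar R).

Definition proper_fun h : Prop :=
  (forall z, h z <> -oo%E) /\ exists z, h z <> +oo%E.

Definition epigraph h : set (X * dual * R) :=
  [set z | (h z.1 <= z.2%:E)%E].

(* the topology is the product of the metric, dual-norm and usual ones *)
Definition lsc_fun h : Prop := closed (epigraph h).

(* The product [0 * +oo] is 0, so the cases l = 0 and l = 1 are trivial; the sum
   [-oo + +oo] cannot occur in [Gamma], where [h] is proper. *)
Definition convex_fun h : Prop :=
  forall (z w : X * dual) (l : R), 0 <= l <= 1 ->
    (h (geodesic_comb z.1 w.1 l, ((1 - l) *: z.2 + l *: w.2)%R)
     <= (1 - l)%R%:E * h z + l%:E * h w)%E.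

Definition Gamma : set (X * dual -> \bar R) :=
  [set h | [/\ proper_fun h, lsc_fun h & convex_fun h]].

Definition pi_fun p (z : X * dual) : R := dual_pairing z.2 p z.1.

Definition swap_fun (z : X * dual) : dual * X := (z.2, z.1).

Definition indicator_fun (A : set (X * dual)) (z : X * dual) : \bar R :=
  if z \in A then 0%E else +oo%E.

Definition fenchel_conjugate p h (z : dual * X) : \bar R :=
  ereal_sup [set ((dual_pairing z.1 p y.1 + dual_pairing y.2 p z.2)%R%:E - h y)%E
            | y in [set: X * dual]].

Definition Gamma_dual p : set (X * dual -> \bar R) :=
  [set h | Gamma h /\
    h = fenchel_conjugate p
          (fun z => h z + indicator_fun [set y | h y <= (pi_fun p y)%:E] z)%E
        \o swap_fun].

Definition graph_of (T : X -> set dual) : set (X * dual) :=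
  [set z | T z.1 z.2].

Definition fitzpatrick_transform p (T : X -> set dual) (z : X * dual) : \bar R :=
  ereal_sup [set (dual_pairing z.2 p y.1 - dual_pairing y.2 z.1 y.1)%:E
            | y in graph_of T].

Definition coincidence_map p h (x : X) : set dual :=
  [set xs | h (x, xs) = (pi_fun p (x, xs))%:E].

End gamma.

(* Main.v *)
Require Import Defs.
From mathcomp Require Import all_boot all_order all_algebra.
From mathcomp Require Import all_classical all_reals all_analysis.
From mathcomp Require Import lra.

Import Order.TTheory GRing.Theory Num.Theory.
Local Open Scope classical_set_scope.
Local Open Scope ring_scope.

(** Where [h <= pi_p], the point itself competes in the supremum defining the
    conjugate, so [h >= 2 pi_p - h] there and hence [h = pi_p].  Thus the
    supremum effectively ranges over the graph of the coincidence map, and by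
    Chasles' relation its terms are those of the Fitzpatrick transform. *)

(** For a single quasilinearization the squared distances to [p] cancel; the general case follows by
    linearity. *)
Lemma dual_action_chasles (R : realType) (X : hadamardType R)
    (f : linear_dual X) (p x y : X) : f (x, y) = f (p, y) - f (p, x) :> R.
Proof.
case: f => f /= /asboolP[n [al [xs [xsP ->]]]].
rewrite !fct_sumE -sumrB; apply: eq_bigr => i _.
have [t [a [b ->]]] := xsP i.
rewrite /GRing.scale/= /GRing.scale/= /quasilin; lra.
Qed.

Lemma fitzpatrick_termE (R : realType) (X : hadamardType R) (p : X)
    (z y : X * linear_dual X) :
  dual_pairing z.2 p y.1 - dual_pairing y.2 z.1 y.1 =
  dual_pairing z.2 p y.1 + dual_pairing y.2 p z.1 - pi_fun p y.
Proof.
rewrite /pi_fun /dual_pairing (dual_action_chasles _ _ y.2 p z.1 y.1).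
by rewrite opprB addrA.
Qed.

Lemma Gamma_dual_coincidence (R : realType) (X : hadamardType R) (p : X)
    (h : X * linear_dual X -> \bar R) (y : X * linear_dual X) :
  Gamma_dual p h -> (h y <= (pi_fun p y)%:E)%E -> h y = (pi_fun p y)%:E.
Proof.
move=> [[[hNy _] _ _] hE] hy.
have : ((pi_fun p y + pi_fun p y)%:E - h y <= h y)%E.
  rewrite [leRHS](congr1 (@^~ y) hE); apply: ereal_sup_ubound.
  exists y => //=; rewrite /indicator_fun ifT ?adde0//.
  by rewrite inE.
(* The value [+oo] contradicts [hy] and [-oo] contradicts properness, so only real arithmetic
   remains. *)
move: hy (hNy y); case: (h y) => [r| |]//.
rewrite -EFinB !lee_fin => hle _ hge; congr EFin; lra.
Qed.

Theorem proposition5p13 (R : realType) (X : hadamardType R) (p : X)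
    (h : X * linear_dual X -> \bar R) (hG : Gamma_dual p h) :
  fitzpatrick_transform p (coincidence_map p h) = h.
Proof.
have [[[hNy _] _ _] hE] := hG.
apply/funext => z; apply/eqP; rewrite eq_le; apply/andP; split.
  rewrite [leRHS](congr1 (@^~ z) hE).
  apply: ge_ereal_sup => _ [y hy <-]; apply: ereal_sup_ubound.
  have {}hy : h y = (pi_fun p y)%:E by rewrite [y]surjective_pairing.
  (* On the graph the indicator vanishes, so each Fitzpatrick term is also a term of the
     conjugate. *)
  exists y => //=; rewrite fitzpatrick_termE /indicator_fun ifT ?adde0 ?hy//.
  by rewrite inE /= hy.
rewrite [leLHS](congr1 (@^~ z) hE).
apply: ge_ereal_sup => _ [y _ <-]; rewrite /indicator_fun.
(* Where [h <= pi_p] fails, the indicator is [+oo] and [h y] is not [-oo], so the term is [-oo]. *)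
case: ifPn => [|_]; last by rewrite addey ?leNye//; exact/eqP.
rewrite inE adde0 => /(Gamma_dual_coincidence _ _ _ _ _ hG) hy.
rewrite hy -EFinB /= -fitzpatrick_termE; apply: ereal_sup_ubound.
by exists y => //; rewrite /graph_of /coincidence_map /= -surjective_pairing.
Qed.
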